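(* Let $G$ be an abelian group with domain $\omega$ (i.e. $G \in \mathrm{AB}_\omega$). If $G$ is co-Hopfian and reduced, then for every prime $p$ the group $\mathrm{Tor}_p(G)$ is finite, and $G$ embeds (as a group) in the profinite group $\prod_{p \in \mathbb{P}} \mathrm{Tor}_p(G)$.
   Context: $\mathrm{AB}_\omega$ is the space of abelian groups with domain $\omega = \mathbb{N}$, and $\mathbb{P}$ is the set of prime numbers. A group $G$ is co-Hopfian if every one-to-one endomorphism of $G$ is onto. An abelian group is reduced if it has no non-zero divisible subgroup. For a prime $p$, $\mathrm{Tor}_p(G)$ is the $p$-torsion subgroup of $G$, i.e. the subgroup of elements whose order is a power of $p$. *)

(* Defs.v *)
From HB Require Import structures.
From mathcomp Require Import all_boot all_order all_algebra.
From mathcomp Require Import boolp classical_sets cardinality.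

Set Implicit Arguments.
Unset Strict Implicit.
Unset Printing Implicit Defensive.

Import GRing.Theory.
Local Open Scope ring_scope.

(* Zero and opposite are determined by the addition, so an element of AB_omega
   amounts to the Cayley table of an abelian group on nat. *)
Record AB_omega := MkAB {
  ab_add : nat -> nat -> nat;
  ab_zero : nat;
  ab_opp : nat -> nat;
  ab_addA : associative ab_add;
  ab_addC : commutative ab_add;
  ab_add0 : left_id ab_zero ab_add;
  ab_addN : left_inverse ab_zero ab_opp ab_add
}.

(* The alias keeps the group structure apart from the standard one on nat. *)
Definition ab_carrier of AB_omega : Type := nat.

Section ABGroup.
Variable G : AB_omega.

HB.instance Definition _ := Choice.copy (ab_carrier G) nat.
HB.instance Definition _ := GRing.isZmodule.Build (ab_carrier G)
  (@ab_addA G) (@ab_addC G) (@ab_add0 G) (@ab_addN G).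

Definition ab_group : zmodType := ab_carrier G.

End ABGroup.

Coercion ab_group : AB_omega >-> GRing.Zmodule.type.

Definition coHopfian (G : zmodType) : Prop :=
  forall f : {additive G -> G}, injective f -> forall y, exists x, f x = y.

Definition is_subgroup (G : zmodType) (H : set G) : Prop :=
  H 0 /\ forall x y, H x -> H y -> H (x - y).

Definition is_divisible (G : zmodType) (H : set G) : Prop :=
  forall n : nat, (0 < n)%N -> forall x, H x -> exists2 y, H y & y *+ n = x.

Definition reduced (G : zmodType) : Prop :=
  forall H : set G, is_subgroup H -> is_divisible H -> H = [set 0]%classic.

Definition has_order (G : zmodType) (x : G) (n : nat) : Prop :=
  [/\ (0 < n)%N, x *+ n = 0
    & forall m : nat, (0 < m)%N -> x *+ m = 0 -> (n <= m)%N].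

Definition Tor (G : zmodType) (p : nat) : set G :=
  [set x | exists k : nat, has_order x (p ^ k)]%classic.

Lemma has_order_dvdn (G : zmodType) (x : G) n m :
  has_order x n -> x *+ m = 0 -> (n %| m)%N.
Proof.
move=> [n0 xn nmin] xm; rewrite /dvdn; case: posnP => // r0.
have xr : x *+ (m %% n) = 0.
  by move: xm; rewrite {1}(divn_eq m n) mulrnDr mulnC mulrnA xn mul0rn add0r.
by have := nmin _ r0 xr; rewrite leqNgt ltn_mod n0.
Qed.

Lemma TorE (G : zmodType) p (x : G) : prime p ->
  Tor p x <-> exists k : nat, x *+ (p ^ k) = 0.
Proof.
move=> pp; split=> [[k [_ xk _]]|[k xk]]; first by exists k.
have ex : exists n, (0 < n)%N && (x *+ n == 0).
  by exists (p ^ k)%N; rewrite expn_gt0 prime_gt0 //= xk.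
have [n /andP[n0 /eqP xn] nmin] := ex_minnP ex.
have ho : has_order x n.
  by split=> // m m0 xm; apply: nmin; rewrite m0 xm eqxx.
have /(dvdn_pfactor _ _ pp)[j _ nE] := has_order_dvdn ho xk.
by exists j; rewrite -nE.
Qed.

Definition primes_set : Type := {p : nat | prime p}.

Section TorGroup.
Variables (G : zmodType) (p : primes_set).

Definition Tor_pred : {pred G} := fun x => `[< Tor (val p) x >].

Fact Tor_zmod_closed : zmod_closed Tor_pred.
Proof.
have pp := valP p; split=> [|x y].
  by apply/asboolP/(TorE _ pp); exists 0; rewrite mul0rn.
move=> /asboolP/(TorE _ pp)[k xk] /asboolP/(TorE _ pp)[l yl].
apply/asboolP/(TorE _ pp); exists (k + l)%N.
by rewrite expnD mulrnBl mulrnA xk mulnC mulrnA yl !mul0rn subrr.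
Qed.

HB.instance Definition _ := GRing.isZmodClosed.Build G Tor_pred Tor_zmod_closed.

Definition Tor_type : Type := {x : G | x \in Tor_pred}.

HB.instance Definition _ := SubChoice.copy Tor_type {x : G | x \in Tor_pred}.
HB.instance Definition _ := [SubChoice_isSubZmodule of Tor_type by <:].

End TorGroup.

Section TorProd.
Variable G : zmodType.

Definition Tor_prod : Type := forall p : primes_set, Tor_type G p.

HB.instance Definition _ := gen_eqMixin Tor_prod.
HB.instance Definition _ := gen_choiceMixin Tor_prod.

Let add (f g : Tor_prod) : Tor_prod := fun p => f p + g p.
Let zero : Tor_prod := fun p => 0.
Let opp (f : Tor_prod) : Tor_prod := fun p => - f p.

Fact Tor_prod_addA : associative add.
Proof. by move=> f g h; apply: functional_extensionality_dep => p; apply: addrA. Qed.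

Fact Tor_prod_addC : commutative add.
Proof. by move=> f g; apply: functional_extensionality_dep => p; apply: addrC. Qed.

Fact Tor_prod_add0 : left_id zero add.
Proof. by move=> f; apply: functional_extensionality_dep => p; apply: add0r. Qed.

Fact Tor_prod_addN : left_inverse zero opp add.
Proof. by move=> f; apply: functional_extensionality_dep => p; apply: addNr. Qed.

HB.instance Definition _ := GRing.isZmodule.Build Tor_prod
  Tor_prod_addA Tor_prod_addC Tor_prod_add0 Tor_prod_addN.

End TorProd.

(* Main.v *)
Require Import Defs.
From HB Require Import structures.
From mathcomp Require Import all_boot all_order all_algebra.
From mathcomp Require Import finmap boolp classical_sets cardinality.

(** Write [S n] for the elements [x] of [G] with [p x = 0] and [x] in [p ^ n G];
this is [socle p n] below. Everything rests on producing homomorphisms from [G]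
to cyclic groups of order [p ^ n], which are injective among the groups killed by
[p ^ n] ([cyclic_injective]): if [s] has order [p] and lies outside a subgroup
[H] containing [p ^ n G], some homomorphism kills [H] and sends [s] to any
prescribed element of order [p] in such a cyclic group ([separating_hom]).

Finiteness of the torsion. Suppose that [Tor p] is infinite. As [G] is reduced,
[S 0] is infinite ([infinite_socle0]). For a finitely generated subgroup [A], the
closure of [A] in the [p]-adic topology is too small to contain an infinite
[S m]: modulo the elements of infinite height it behaves like a finitely
generated module over the [p]-adic integers ([socle_closure]), whereas in a
reduced group no [S m] other than [0] consists of elements of infinite height
([reduced_Tor_bounded]). So, [G] being countable, one can choose elements [s_0],
[s_1], ... of order [p], each outside the closure of the group generated by its
predecessors and by ever more elements of [G], with [s_n.+1] so high that some
[psi_n : G -> G] with cyclic image kills this group and sends [s_n] to [s_n.+1]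
([far_sequence]). Each element of [G] is killed by almost all [psi_n], hence
[phi], the sum of the [psi_n], is an endomorphism. It acts on the span of the
[s_n] as a shift, up to lower terms, and therefore [id - phi] is injective and
misses [s_0] ([shift_inj], [shift_not_surj]): [G] is not co-Hopfian.

The embedding. Suppose that the group [Tor p] is finite. There is a homomorphism
[phi : G -> Tor p] which is injective on the elements of order [p], built by
descending induction on their heights ([socle_hom_step]). The endomorphism
[x |-> p x + phi x] is then injective, hence onto, so that [G = Tor p + p G]; by
iteration [G] is the direct sum of [Tor p] and a [p]-divisible subgroup [p ^ k G]
([Tor_plus_multiples], [Tor_complement]). The projections to the groups [Tor p]
have a common kernel that is divisible, because dividing by [p] is possible in
[p ^ k G] and does not disturb the other projections. As [G] is reduced, this
kernel is [0] ([coHopfian_embeds_in_Tor_prod]). *)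

Set Implicit Arguments.
Unset Strict Implicit.
Unset Printing Implicit Defensive.

Import GRing.Theory.
Local Open Scope ring_scope.
Local Open Scope classical_set_scope.

(** * Subgroups, orders and divisibility *)

Lemma subrACA (G : zmodType) (x y z t : G) :
  x - y - (z - t) = (x - z) - (y - t).
Proof. by rewrite opprD addrACA -opprD. Qed.

Section Subgroup.
Variables (G : zmodType) (H : set G) (sgH : is_subgroup H).

Lemma subgroupB x y : H x -> H y -> H (x - y).
Proof. exact: sgH.2. Qed.

Lemma subgroupN x : H x -> H (- x).
Proof. by move=> Hx; rewrite -sub0r; apply: subgroupB => //; exact: sgH.1. Qed.

Lemma subgroupD x y : H x -> H y -> H (x + y).
Proof. by move=> Hx /subgroupN Hy; rewrite -(opprK y); exact: subgroupB. Qed.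

Lemma subgroupMn x n : H x -> H (x *+ n).
Proof.
move=> Hx; elim: n => [|n IHn]; first by rewrite mulr0n; exact: sgH.1.
by rewrite mulrS; exact: subgroupD.
Qed.

Lemma subgroupMz x (c : int) : H x -> H (x *~ c).
Proof.
move=> Hx; case: c => n; first exact: subgroupMn.
by rewrite NegzE mulrNz; apply/subgroupN/subgroupMn.
Qed.

End Subgroup.

Section Orders.
Variable G : zmodType.
Implicit Types (x y : G) (p : nat).

Lemma has_order_dvdz x n (c : int) :
  has_order x n -> x *~ c = 0 -> (n %| `|c|)%N.
Proof.
move=> ho xc; apply: (has_order_dvdn ho).
by case: c xc => m //=; rewrite NegzE mulrNz => /eqP; rewrite oppr_eq0 => /eqP.
Qed.

Lemma has_order_prime_power p k x :
  prime p -> x *+ (p ^ k) != 0 -> x *+ (p ^ k.+1) = 0 -> has_order x (p ^ k.+1).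
Proof.
move=> pp xk xk1; have /(TorE _ pp)[j ho] : exists k, x *+ (p ^ k) = 0.
  by exists k.+1.
have /(dvdn_pfactor _ _ pp)[i ik jE] := has_order_dvdn ho xk1.
suff -> : k.+1 = j by [].
apply/eqP; move: ik; rewrite leq_eqVlt => /orP[/eqP <-|ik].
  by rewrite -(eqn_exp2l _ _ (prime_gt1 pp)) jE.
case/eqP: xk; have [_ xj _] := ho.
have /subnK <- : (i <= k)%N by [].
by rewrite expnD mulnC mulrnA -jE xj mul0rn.
Qed.

(** By the theorem of Bezout, [c] is invertible modulo [N]. *)
Lemma coprime_mulrnK x N (c : int) : x *+ N = 0 -> coprimez c N ->
  exists d : int, x *~ c *~ d = x.
Proof.
move=> xN; rewrite /coprimez => /eqP co; have [u [v uv]] := Bezoutz c N.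
exists u; rewrite -mulrzA mulrC.
have -> : u * c = 1 - v * N by rewrite -co -uv addrK.
by rewrite mulrzBr mulr1z mulrC mulrzA -pmulrn xN mul0rz subr0.
Qed.

Lemma dvdn_mulrz0 p x (c : int) : x *+ p = 0 -> (p %| `|c|)%N -> x *~ c = 0.
Proof.
move=> xp /dvdnP[q cE]; rewrite (intEsign c) cE mulrC mulnC PoszM -mulrA mulrzA.
by rewrite -pmulrn xp mul0rz.
Qed.

Lemma prime_mulrzK p x (c : int) : prime p -> x *+ p = 0 ->
  (p %| `|c|)%N \/ exists d : int, x *~ c *~ d = x.
Proof.
move=> pp xp; have [|pc] := boolP (p %| `|c|)%N; first by left.
by right; apply: coprime_mulrnK xp _; rewrite coprimezE coprime_sym prime_coprime.
Qed.

End Orders.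

Lemma Tor_subgroup (G : zmodType) p : prime p -> is_subgroup (@Tor G p).
Proof.
move=> pp; have [T0 TB] := Tor_zmod_closed G (exist _ p pp : primes_set).
by split=> [|x y Tx Ty]; apply/asboolP => //; apply: TB; exact/asboolP.
Qed.

Lemma divisible_by_primes (G : zmodType) (H : set G) :
  (forall q, prime q -> forall x, H x -> exists2 y, H y & y *+ q = x) ->
  is_divisible H.
Proof.
move=> divH n; elim/ltn_ind: n => n IHn n0 x Hx.
have [n1|n1] := leqP n 1.
  by exists x => //; have -> : n = 1%N by apply/eqP; rewrite eqn_leq n1.
have [y Hy <-] := divH _ (pdiv_prime n1) x Hx.
have nE : (n %/ pdiv n * pdiv n)%N = n by rewrite divnK ?pdiv_dvd.
have [||z Hz <-] := IHn (n %/ pdiv n)%N _ _ y Hy.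
- by rewrite ltn_Pdiv ?prime_gt1 ?pdiv_prime.
- by rewrite divn_gt0 ?pdiv_gt0 // pdiv_leq.
- by exists z => //; rewrite -mulrnA nE.
Qed.

(** * Finite sets *)

Lemma minimal_subset (T : choiceType) (P : set (set T)) (X0 : set T) :
    finite_set X0 -> P X0 ->
  exists X, [/\ P X, X `<=` X0 & forall Y, P Y -> Y `<=` X -> X `<=` Y].
Proof.
move=> finX0 PX0; pose card (X : set T) := #|` fset_set X|.
pose Q n := exists X, [/\ P X, X `<=` X0 & card X = n].
have ex : exists n, `[< Q n >].
  by exists (card X0); apply/asboolP; exists X0; split=> // x.
have [n /asboolP[X [PX XX0 cX]] nmin] := ex_minnP ex.
exists X; split=> // Y PY YX.
have finX : finite_set X := sub_finite_set XX0 finX0.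
have finY : finite_set Y := sub_finite_set YX finX.
suff /(fset_set_inj finY finX) -> : fset_set Y = fset_set X by [].
have sub : (fset_set Y `<=` fset_set X)%fset by rewrite -fset_set_sub.
apply/eqP; rewrite eqEfcard sub /= -/(card X) cX; apply: nmin.
apply/asboolP; exists Y; split=> //.
exact: subset_trans XX0.
Qed.

Lemma finite_surj_inj (T : eqType) (A : set T) (f : T -> T) : finite_set A ->
    (forall y, A y -> exists2 x, A x & f x = y) ->
  forall x y, A x -> A y -> f x = f y -> x = y.
Proof.
move=> /finite_seqP[l0 AE] surj x y Ax Ay fxy; apply/eqP/contraT => xy.
pose l := undup l0.
have Al z : A z <-> z \in l by rewrite AE mem_undup.
have : (size l <= size (map f (rem x l)))%N.
  apply: uniq_leq_size; first exact: undup_uniq.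
  move=> _ /Al/surj[z /Al zl <-].
  have [->|zx] := eqVneq z x.
    rewrite fxy map_f // mem_rem_uniq ?undup_uniq // inE eq_sym xy.
    exact/Al.
  by rewrite map_f // mem_rem_uniq ?undup_uniq // inE zx.
have lx : x \in l by apply/Al.
by rewrite size_map size_rem // -ltnS prednK ?ltnn //; case: (l) lx.
Qed.

(** * Finitely generated subgroups and heights *)

Section Spans.
Variable G : zmodType.
Implicit Types (x y a : G) (l : seq G).

Definition multiples (N : nat) : set G := [set x | exists y, y *+ N = x].

(** The subgroup generated by [N G] and [l]; the recursion singles out the first
generator, for proofs by induction on the number of generators. *)
Fixpoint span_mod (N : nat) (l : seq G) : set G :=
  if l is a :: l' then [set x | exists c : int, span_mod N l' (x - a *~ c)]
  else multiples N.

Lemma multiples_dvdn M N : (M %| N)%N -> multiples N `<=` multiples M.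
Proof.
by move=> /dvdnP[q ->] x [y <-]; exists (y *+ q); rewrite -mulrnA.
Qed.

Lemma multiples_subgroup N : is_subgroup (multiples N).
Proof.
split=> [|x y [x' <-] [y' <-]]; first by exists 0; rewrite mul0rn.
by exists (x' - y'); rewrite mulrnBl.
Qed.

Lemma span_mod_cons N a l : span_mod N l `<=` span_mod N (a :: l).
Proof. by move=> x Hx; exists 0; rewrite mulr0z subr0. Qed.

Lemma span_mod_subgroup N l : is_subgroup (span_mod N l).
Proof.
elim: l => [|a l sgl]; first exact: multiples_subgroup.
split=> [|x y [b xb] [c yc]]; first by apply: span_mod_cons; exact: sgl.1.
by exists (b - c); rewrite mulrzBr subrACA; exact: subgroupB.
Qed.

Lemma multiples_span_mod N l : multiples N `<=` span_mod N l.
Proof. by elim: l => [//|a l IHl] x /IHl; exact: span_mod_cons. Qed.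

Lemma mem_span_mod N l a : a \in l -> span_mod N l a.
Proof.
elim: l => [//|b l IHl]; rewrite inE => /predU1P[->|/IHl]; last exact: span_mod_cons.
by exists 1; rewrite mulr1z subrr; exact: (span_mod_subgroup N l).1.
Qed.

Lemma span_mod_sub N l (H : set G) : is_subgroup H -> multiples N `<=` H ->
  (forall a, a \in l -> H a) -> span_mod N l `<=` H.
Proof.
move=> sgH NH; elim: l => [//|a l IHl] lH x [c xc].
rewrite -(subrK (a *~ c) x); apply: subgroupD => //.
  by apply: IHl xc => b bl; apply: lH; rewrite inE bl orbT.
by apply: subgroupMz => //; apply: lH; rewrite mem_head.
Qed.

Lemma span_mod_dvdn M N l : (M %| N)%N -> span_mod N l `<=` span_mod M l.
Proof.
move=> MN; apply: span_mod_sub; first exact: span_mod_subgroup.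
  by apply: subset_trans (@multiples_span_mod M l); exact: multiples_dvdn.
by move=> a; exact: mem_span_mod.
Qed.

(** Modulo [N G] only the residues of the coefficients matter, so each new
generator replaces the trace of the span on [X] by at most [N] of its cosets. *)
Lemma finite_span_mod N l (X : set G) : (0 < N)%N -> is_subgroup X ->
  finite_set (X `&` multiples N) -> finite_set (X `&` span_mod N l).
Proof.
move=> N0 sgX finX; elim: l => [//|a l IHl].
pose Y (c : nat) := X `&` [set x | span_mod N l (x - a *+ c)].
apply: (@sub_finite_set _ _ (\bigcup_(c in `I_N) Y c)).
  move=> x [Xx [c xc]]; have cN : (c %% N)%Z = `|(c %% N)%Z|%N.
    by rewrite gez0_abs // modz_ge0 // -lt0n.
  exists `|(c %% N)%Z|%N.
    by rewrite /= -ltz_nat -cN ltz_pmod.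
  split=> //=; rewrite pmulrn -cN.
  have -> : x - a *~ (c %% N)%Z = (x - a *~ c) + a *~ (c %/ N)%Z *+ N.
    move: (divz_eq c N); move: (c %/ N)%Z (c %% N)%Z => q r ->.
    by rewrite mulrzDr mulrzA -pmulrn opprD addrA addrAC subrK.
  apply: subgroupD xc _; first exact: span_mod_subgroup.
  by apply: multiples_span_mod; exists (a *~ (c %/ N)%Z).
apply: bigcup_finite => [|c _]; first exact: finite_II.
have [[x0 [Xx0 x0c]]|noY] := pselect (exists x, Y c x); last first.
  by apply: sub_finite_set (finite_set0 G) => x Yx; case: noY; exists x.
apply: (@sub_finite_set _ _ ((fun x => x + x0) @` (X `&` span_mod N l))).
  move=> x [Xx xc]; exists (x - x0); last by rewrite subrK.
  split; first exact: subgroupB.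
  have -> : x - x0 = (x - a *+ c) - (x0 - a *+ c) by rewrite opprB addrA subrK.
  by apply: subgroupB => //; exact: span_mod_subgroup.
exact: finite_image.
Qed.

End Spans.

(** The gcds of [b] and [c] with [p ^ n] are powers of [p], so one of them divides
the other; a gcd being a combination of its arguments, the integer with the
smaller gcd then divides the other one modulo [p ^ n]. *)
Lemma prime_power_comparable p n (b c : int) : prime p ->
  (exists d : int, (p ^ n %| `|(b - d * c)%R|)%N) \/
  (exists d : int, (p ^ n %| `|(c - d * b)%R|)%N).
Proof.
move=> pp.
have gcd_pow z : exists i : nat, gcdz z (p ^ n)%N = (p ^ i)%N.
  have /(dvdn_pfactor _ _ pp)[i _ iE] : (gcdn `|z| (p ^ n) %| p ^ n)%N.
    exact: dvdn_gcdr.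
  by exists i; rewrite /gcdz iE.
have key (b' c' : int) (i j : nat) : gcdz b' (p ^ n)%N = (p ^ i)%N ->
    gcdz c' (p ^ n)%N = (p ^ j)%N -> (i <= j)%N ->
    exists d : int, (p ^ n %| `|(c' - d * b')%R|)%N.
  move=> bi cj ij; have [u [v uv]] := Bezoutz b' (p ^ n)%N.
  have /dvdzP[k ck] : (gcdz b' (p ^ n)%N %| c')%Z.
    rewrite bi; apply: (@dvdz_trans (p ^ j)%N); first by rewrite dvdzE dvdn_exp2l.
    by rewrite -cj dvdz_gcdl.
  exists (k * u); rewrite {1}ck -uv mulrDr mulrA addrC addKr mulrA.
  by rewrite abszM dvdn_mull.
have [i bi] := gcd_pow b; have [j cj] := gcd_pow c.
have [ij|/ltnW ji] := leqP i j; [right|left].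
  exact: key bi cj ij.
exact: key cj bi ji.
Qed.

Section Socle.
Variables (G : zmodType) (p : nat).
Hypothesis pp : prime p.
Implicit Types (x y a : G) (l : seq G).

Definition socle (n : nat) : set G := [set x | x *+ p = 0] `&` @multiples G (p ^ n).

Lemma socle_subgroup n : is_subgroup (socle n).
Proof.
have [m0 mB] := multiples_subgroup G (p ^ n).
split=> [|x y [/= xp xm] [/= yp ym]]; first by split=> //=; rewrite mul0rn.
by split=> /=; [rewrite mulrnBl xp yp subrr|exact: mB].
Qed.

Lemma socle_le m n : (m <= n)%N -> socle n `<=` socle m.
Proof.
by move=> mn x [xp xm]; split=> //; apply: multiples_dvdn xm; exact: dvdn_exp2l.
Qed.

Lemma socle_Tor n x : socle n x -> exists2 y, Tor p y & y *+ p ^ n = x.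
Proof.
move=> [/= xp [y yx]]; exists y => //; apply/(TorE _ pp); exists n.+1.
by rewrite expnSr mulrnA yx.
Qed.

(** Adding one generator [a] to a finitely generated group enlarges the trace of
its [p]-adic closure on a socle by at most one dimension: two elements of the
socle congruent to multiples of [a] are proportional, since multiples of [a] are
comparable for divisibility. Here [s2] is so high that it lies in [p ^ n1 G], so
[s1] cannot be a multiple of [s2] modulo the group generated by [l]; nor can [s2]
be a multiple of [s1], unless that multiple vanishes. *)
Lemma socle_closure_step m a l :
    (forall n, socle m `<=` span_mod (p ^ n) (a :: l)) ->
  exists m', forall n, socle m' `<=` span_mod (p ^ n) l.
Proof.
move=> cl; apply: contrapT => ncl.
have far m' : exists n, exists2 s, socle m' s & ~ span_mod (p ^ n) l s.
  apply: contrapT => nfar; apply: ncl; exists m' => n s Ss.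
  by apply: contrapT => ns; apply: nfar; exists n; exists s.
have [n1 [s1 S1 s1n]] := far m.
have [n2 [s2 S2 s2n]] := far (maxn m n1).
pose n := maxn n1 n2.
have sg k := span_mod_subgroup k l.
have [c1 h1] := cl n _ S1.
have [c2 h2] := cl n _ (socle_le (leq_maxl _ _) S2).
have near_n1 s : span_mod (p ^ n) l s -> span_mod (p ^ n1) l s.
  by apply: span_mod_dvdn; apply: dvdn_exp2l; exact: leq_maxl.
have near_n2 s : span_mod (p ^ n) l s -> span_mod (p ^ n2) l s.
  by apply: span_mod_dvdn; apply: dvdn_exp2l; exact: leq_maxr.
have s2n1 : span_mod (p ^ n1) l s2.
  by apply: multiples_span_mod; have [] := socle_le (leq_maxr _ _) S2.
have comb s t (b c d : int) : span_mod (p ^ n) l (s - a *~ b) ->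
    span_mod (p ^ n) l (t - a *~ c) -> (p ^ n %| `|(b - d * c)%R|)%N ->
    span_mod (p ^ n) l (s - t *~ d).
  move=> hs ht /dvdnP[q qE].
  have -> : s - t *~ d = (s - a *~ b) - (t - a *~ c) *~ d + a *~ (b - d * c).
    rewrite mulrzBl mulrzBr opprB -(mulrzA a) (mulrC d) [RHS]addrACA subrK.
    by rewrite addrAC subrr add0r.
  apply: subgroupD => //; first by apply: subgroupB => //; apply: subgroupMz.
  apply: multiples_span_mod; rewrite (intEsign (b - d * c)) qE PoszM mulrA mulrzA.
  by eexists; rewrite pmulrn.
have S1p : s1 *+ p = 0 by case: S1.
have [[d dc]|[d dc]] := prime_power_comparable n c1 c2 pp.
  apply: s1n; rewrite -(subrK (s2 *~ d) s1); apply: subgroupD => //.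
    exact: near_n1 (comb _ _ _ _ _ h1 h2 dc).
  exact: subgroupMz.
have near := comb _ _ _ _ _ h2 h1 dc.
have [pd|[d' dE]] := prime_mulrzK d pp S1p.
  by apply: s2n; apply: near_n2; rewrite (dvdn_mulrz0 S1p pd) subr0 in near.
apply: s1n; rewrite -dE; apply: subgroupMz => //.
rewrite -(subKr s2 (s1 *~ d)); apply: subgroupB => //; exact: near_n1.
Qed.

(** When all generators have been removed, what is left is [p ^ n G] itself. *)
Lemma socle_closure l m : (forall n, socle m `<=` span_mod (p ^ n) l) ->
  exists m', forall n, socle m' `<=` socle n.
Proof.
elim: l m => [|a l IHl] m cl; last by have [m' /IHl] := socle_closure_step cl.
by exists m => n x Sx; have [xp _] := Sx; split=> //; exact: cl.
Qed.

End Socle.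

(** * Homomorphisms to cyclic groups *)

Section CyclicInjective.
Variables (G E : zmodType) (N : nat) (e : E).

Lemma pairMz (u : G * E) (k : int) : u *~ k = (u.1 *~ k, u.2 *~ k).
Proof.
have pairMn n : u *+ n = (u.1 *+ n, u.2 *+ n).
  by elim: n => [//|n IHn]; rewrite !mulrS IHn.
by case: k => n; [exact: pairMn|rewrite !NegzE !mulrNz -!pmulrn pairMn].
Qed.

(* [R] is the graph of a homomorphism from a subgroup containing [N G] to [<e>]
which vanishes on [N G]. *)
Let good (R : set (G * E)) := [/\ is_subgroup R, forall x, R (x *+ N, 0),
  forall y, R (0, y) -> y = 0 & forall u, R u -> exists c : int, u.2 = e *~ c].

(** Among the graphs of partial homomorphisms extending [R0], Zorn's lemma gives a
maximal one, [A]. It is total: let [d] be the least positive multiplier that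
brings [x] into its domain, so that [d] divides [N]. The value [y] at [d x] is
killed by [N / d], as [N x] has value [0], and in a cyclic group of order [N]
such an element is [d] times another one, which can be taken as the value at
[x]. *)
Lemma cyclic_injective (R0 : set (G * E)) : has_order e N -> is_subgroup R0 ->
    (forall x, R0 (x *+ N, 0)) -> (forall y, R0 (0, y) -> y = 0) ->
    (forall u, R0 u -> exists c : int, u.2 = e *~ c) ->
  exists psi : {additive G -> E},
    (forall u, R0 u -> psi u.1 = u.2) /\ forall x, exists c : int, psi x = e *~ c.
Proof.
move=> he sg0 N0 f0 v0; have gR0 : good R0 by [].
pose P (R : set (G * E)) := R = set0 \/ (good R /\ R0 `<=` R).
have [|A [PA maxA]] := @Zorn_bigcup _ P.
  move=> F FP Ftot.
  (* [set0] satisfies [P] so that the union of an empty chain does; as soon as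
  the chain has a nonempty member, the union is a graph. *)
  have [[X [FX [gX RX]]]|noX] := pselect (exists X, F X /\ (good X /\ R0 `<=` X)).
    have Fgood Y u : F Y -> Y u -> good Y.
      by move=> FY Yu; have [Y0|[gY _]] := FP _ FY; first by rewrite Y0 in Yu.
    have [sgX NX fX vX] := gX.
    right; split; last by move=> u /RX Xu; exists X.
    split.
    - split; first by exists X => //; exact: sgX.1.
      move=> u v [Y FY Yu] [Z FZ Zv].
      have [[_ sgY] _ _ _] := Fgood _ _ FY Yu.
      have [[_ sgZ] _ _ _] := Fgood _ _ FZ Zv.
      have [YZ|ZY] := Ftot _ _ FY FZ.
        by exists Z => //; apply: sgZ => //; apply: YZ.
      by exists Y => //; apply: sgY => //; apply: ZY.
    - by move=> x; exists X => //; apply: NX.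
    - by move=> y [Y FY Yy]; have [_ _ + _] := Fgood _ _ FY Yy; exact.
    - by move=> u [Y FY Yu]; have [_ _ _ +] := Fgood _ _ FY Yu; exact.
  left; rewrite -subset0 => u [Y FY Yu]; have [Y0|gY] := FP _ FY.
    by rewrite Y0 in Yu.
  by apply: noX; exists Y.
have [sgA NA fA vA] : good A.
  case: PA => [A0|[gA _] //]; exfalso.
  have /(maxA R0) : A `<` R0 by rewrite A0; split=> // R00; exact: (R00 0 sg0.1).
  by apply; right; split=> // u.
have RA : R0 `<=` A.
  by case: PA => [A0|[_ RA] //]; move: (NA 0); rewrite A0.
have Afun x y z : A (x, y) -> A (x, z) -> y = z.
  move=> Ay Az; apply/eqP; rewrite -subr_eq0; apply/eqP/fA.
  by have := subgroupB sgA Ay Az; rewrite /= -[(x, y) - (x, z)]/(x - x, y - z) subrr.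
have Atot x : exists y, A (x, y).
  apply: contrapT => xA; have [N0' eN _] := he.
  have ex : exists d, (0 < d)%N && `[< exists y, A (x *+ d, y) >].
    by exists N; rewrite N0' /=; apply/asboolP; exists 0; exact: NA.
  have [d /andP[d0 /asboolP[y Ady]] dmin] := ex_minnP ex.
  have ddvd n z : A (x *+ n, z) -> (d %| n)%N.
    move=> An; rewrite /dvdn; case: posnP => // r0.
    suff : (d <= n %% d)%N by rewrite leqNgt ltn_mod d0.
    apply: dmin; rewrite r0 /=; apply/asboolP.
    exists (z - y *+ (n %/ d)).
    have -> : x *+ (n %% d) = x *+ n - (x *+ d) *+ (n %/ d).
      by rewrite -mulrnA mulnC {2}(divn_eq n d) mulrnDr addrC addKr.
    have := subgroupB sgA An (subgroupMz sgA (Posz (n %/ d)) Ady).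
    by rewrite pairMz.
  have dN : (d %| N)%N := ddvd _ _ (NA x).
  have [c yE] : exists c : int, y = e *~ c := vA _ Ady.
  have [c' cE] : exists c' : int, c = c' * d.
    have yN : y *+ (N %/ d) = 0.
      apply: Afun (NA x).
      have := subgroupMz sgA (Posz (N %/ d)) Ady; rewrite pairMz /= -!pmulrn.
      by rewrite -mulrnA mulnC divnK.
    have /(has_order_dvdz he) : e *~ (c * (N %/ d)%N) = 0.
      by rewrite mulrzA -yE -pmulrn.
    rewrite abszM /= -{1}(divnK dN) mulnC dvdn_pmul2r ?divn_gt0 ?(dvdn_leq N0') //.
    by move=> dc; apply/dvdzP; rewrite dvdzE.
  pose w : G * E := (x, e *~ c').
  have Aw : A (w *~ d).
    by rewrite pairMz /= -mulrzA -cE -yE -pmulrn.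
  pose B : set (G * E) := [set u | exists k : int, A (u - w *~ k)].
  have AB : A `<=` B by move=> u Au; exists 0; rewrite mulr0z subr0.
  apply: (maxA B).
    split=> // BA; apply: xA; exists (e *~ c'); apply: (BA w).
    by exists 1; rewrite mulr1z subrr; exact: sgA.1.
  right; split; last exact: subset_trans AB.
  split.
  - split; first by apply: AB; exact: sgA.1.
    move=> u v [k Au] [l Av]; exists (k - l).
    by rewrite mulrzBr subrACA; exact: subgroupB.
  - by move=> z; apply: AB.
  - move=> z [k Ak]; apply: fA.
    have /dvdnP[q kE] : (d %| `|k|)%N.
      move: Ak; rewrite pairMz => /(subgroupN sgA) /=.
      rewrite -[- _]/(- (0 - x *~ k), - (z - e *~ c' *~ k)) sub0r opprK.
      case: k => n; first exact: ddvd.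
      rewrite NegzE mulrNz => /(subgroupN sgA).
      rewrite -[- _]/(- (- (x *~ n.+1)), - - (z - e *~ c' *~ - n.+1%:Z)) opprK.
      exact: ddvd.
    have Awk : A (w *~ k).
      rewrite (intEsign k) kE mulrC PoszM -mulrA mulrC -mulrA mulrzA.
      by apply: subgroupMz => //; rewrite mulrC.
    by rewrite -(subrK (w *~ k) (0, z)); exact: subgroupD.
  - move=> u [k Au]; have [b bE] := vA _ Au; exists (b + c' * k).
    by move: bE; rewrite pairMz mulrzDr mulrzA => <-; rewrite subrK.
have /choice[psi psiE] := Atot.
have psiB : zmod_morphism psi.
  move=> x y; apply: Afun (psiE _) _.
  exact: (subgroupB sgA (psiE x) (psiE y)).
pose psiM := GRing.isZmodMorphism.Build _ _ psi psiB.
pose psiA : {additive G -> E} := HB.pack psi psiM.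
exists psiA; split=> [[x y] /RA Axy|x].
  by apply: Afun Axy; exact: psiE.
exact: vA (psiE x).
Qed.
End CyclicInjective.

(** Sending [h + c s] to [c s'], for [h] in [H], is well defined, because [c s] lies
in [H] only if [p] divides [c], and vanishes on [p ^ k.+1 G]. The values lie in
the cyclic group generated by a [p ^ k]-th root of [s'], which has order
[p ^ k.+1], so that [cyclic_injective] extends this homomorphism to [G]. *)
Lemma separating_hom (G : zmodType) (p k : nat) (H : set G) (s s' : G) :
    prime p -> is_subgroup H -> multiples (p ^ k.+1) `<=` H ->
    s *+ p = 0 -> ~ H s -> socle p k s' -> s' != 0 ->
  exists psi : {additive G -> G},
    [/\ forall x, H x -> psi x = 0, psi s = s',
        forall x, psi x *+ (p ^ k.+1) = 0
      & forall x, x *+ p = 0 -> exists c : int, psi x = s' *~ c].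
Proof.
move=> pp sgH NH sp Hs [/= s'p [e eE]] s'0.
have e0 : e *+ (p ^ k.+1) = 0 by rewrite expnSr mulrnA eE.
have he : has_order e (p ^ k.+1) by apply: has_order_prime_power => //; rewrite eE.
pose R0 : set (G * G) := [set u | exists c : int, H (u.1 - s *~ c) /\ u.2 = s' *~ c].
have HR x : H x -> R0 (x, 0) by exists 0; rewrite !mulr0z subr0.
have [||||psi [psiR psie]] := @cyclic_injective _ _ _ e R0 he.
- split=> [|[x1 y1] [x2 y2] [b [/= xb ->]] [c [/= xc ->]]].
    by apply: HR; exact: sgH.1.
  exists (b - c); split; rewrite /= mulrzBr //.
  by rewrite subrACA; exact: subgroupB.
- by move=> x; apply: HR; apply: NH; exists x.
- move=> y [c [/=]]; rewrite sub0r => /(subgroupN sgH); rewrite opprK => sc ->.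
  have [pc|[d dE]] := prime_mulrzK c pp sp; first exact: dvdn_mulrz0 pc.
  by case: Hs; rewrite -dE; exact: subgroupMz.
- move=> u [c [_ ->]]; exists ((p ^ k)%N%:Z * c).
  by rewrite mulrzA -pmulrn eE.
exists psi; split.
- by move=> x /HR /psiR.
- by apply: (psiR (s, s')); exists 1; rewrite !mulr1z subrr; split=> //; exact: sgH.1.
- by move=> x; have [c ->] := psie x; rewrite pmulrn mulrzAC -pmulrn e0 mul0rz.
move=> x xp; have [c cE] := psie x.
have /(has_order_dvdz he) : e *~ (c * p) = 0.
  by rewrite mulrzA -cE -pmulrn -raddfMn xp raddf0.
rewrite abszM /= expnSr dvdn_pmul2r ?prime_gt0 // => /dvdnP[q qE].
rewrite cE (intEsign c) qE; exists ((-1) ^+ (c < 0)%R * q%:Z).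
by rewrite PoszM mulrA mulrC mulrzA -pmulrn eE.
Qed.

(** * Infinite torsion in a reduced group *)

Section InfiniteSocle.
Variables (G : zmodType) (p : nat).
Hypotheses (pp : prime p) (redG : reduced G).
Implicit Types (x y : G) (l : seq G).

(** If the elements of [socle N] have infinite height then [p ^ N] times the
[p]-torsion is divisible: an element of order [p ^ k.+1] there differs by an
element of order at most [p ^ k] from one that is divisible by a higher power. *)
Lemma reduced_Tor_bounded N : (forall n, @socle G p N `<=` @socle G p n) ->
  forall x, Tor p x -> x *+ (p ^ N) = 0.
Proof.
move=> hN; have divp k y : y *+ (p ^ N) *+ (p ^ k) = 0 ->
    exists z, z *+ (p ^ N.+1) = y *+ (p ^ N).
  elim: k y => [|k IHk] y yk.
    by exists 0; rewrite mul0rn -[RHS]mulr1n -(expn0 p) yk.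
  have Sy : @socle G p N (y *+ p ^ N *+ p ^ k).
    split; first by rewrite /= -mulrnA -expnSr.
    by exists (y *+ p ^ k); rewrite mulrnAC.
  have [_ [z zy]] := hN (N.+1 + k)%N _ Sy.
  have [|z' z'E] := IHk (y - z *+ p).
    by rewrite !mulrnBl -zy expnD expnS !mulrnA subrr.
  exists (z' + z).
  by rewrite mulrnDl z'E mulrnBl -mulrnA -expnS subrK; reflexivity.
pose H : set G := [set x | exists2 y, Tor p y & y *+ (p ^ N) = x].
suff H0 : H = [set 0].
  by move=> x Tx; have : H (x *+ p ^ N) by [exists x]; rewrite H0.
apply: redG.
  have sgT := Tor_subgroup G pp.
  split; first by exists 0; [exact: sgT.1|rewrite mul0rn].
  move=> x y [x' Tx <-] [y' Ty <-].
  by exists (x' - y'); [exact: subgroupB|rewrite mulrnBl].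
apply: divisible_by_primes => q pq x [y /(TorE _ pp)[k yk] <-].
have [qp|qp] := eqVneq q p.
  have [|z zE] := divp k y; first by rewrite mulrnAC yk mul0rn.
  exists (z *+ (p ^ N)); last by rewrite qp -mulrnA -expnSr.
  exists z => //; apply/(TorE _ pp); exists (N.+1 + k)%N.
  by rewrite expnD mulrnA zE mulrnAC yk mul0rn.
have [d dE] : exists d : int, y *~ q *~ d = y.
  apply: coprime_mulrnK yk _; rewrite coprimezE /= coprimeXr //.
  by rewrite prime_coprime // dvdn_prime2.
exists (y *~ d *+ p ^ N).
  exists (y *~ d) => //; apply/(TorE _ pp); exists k.
  by rewrite pmulrn mulrzAC -pmulrn yk mul0rz.
by rewrite mulrnAC; congr (_ *+ _); rewrite pmulrn mulrzAC.
Qed.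

(** Multiplication by [p] maps the elements killed by [p ^ k.+1] to those killed by
[p ^ k], and its fibers are cosets of [socle p 0]. *)
Lemma finite_Tor N : (forall x, Tor p x -> x *+ (p ^ N) = 0) ->
  finite_set (@socle G p 0) -> finite_set (@Tor G p).
Proof.
move=> TN finS.
suff fin k : finite_set [set x : G | x *+ (p ^ k) = 0].
  by apply: sub_finite_set (fin N) => x; exact: TN.
elim: k => [|k IHk].
  by apply: sub_finite_set (finite_set1 0) => x; rewrite /= expn0 mulr1n.
apply: (@sub_finite_set _ _ (\bigcup_(z in [set z : G | z *+ (p ^ k) = 0])
    [set x | x *+ p = z])).
  by move=> x; rewrite /= expnS mulrnA => xk; exists (x *+ p).
apply: bigcup_finite => // z _.
have [[x0 /= x0z]|noz] := pselect (exists x, x *+ p = z); last first.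
  by apply: sub_finite_set (finite_set0 G) => x xz; case: noz; exists x.
apply: sub_finite_set (finite_image (fun x => x + x0) finS) => x /= xz.
exists (x - x0); last by rewrite subrK.
by split; [rewrite /= mulrnBl xz x0z subrr|exists (x - x0)].
Qed.

(** Were every [socle k] with [k >= m] that is infinite to bring [socle m] into
[p ^ k.+1 G + <l>], all of them would be infinite by [finite_span_mod], and
[socle m] would lie in the closure of [<l>], against [socle_closure]. *)
Lemma infinite_socle_far m l : infinite_set (@socle G p m) ->
  exists k s, [/\ infinite_set (@socle G p k), @socle G p m s
                & ~ span_mod (p ^ k.+1) l s].
Proof.
move=> infm; apply: contrapT => nfar.
have near k : (m <= k)%N -> infinite_set (@socle G p k) ->
    @socle G p m `<=` span_mod (p ^ k.+1) l.
  move=> mk infk s Ss; apply: contrapT => ns; apply: nfar.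
  by exists k; exists s.
have inf k : (m <= k)%N -> infinite_set (@socle G p k).
  elim: k => [|k IHk]; first by rewrite leqn0 => /eqP <-.
  rewrite leq_eqVlt => /predU1P[<- //|mk] fink; apply: infm.
  have -> : @socle G p m = @socle G p m `&` span_mod (p ^ k.+1) l.
    by apply/esym/setIidPl; apply: near => //; exact: IHk.
  apply: finite_span_mod; first by rewrite expn_gt0 prime_gt0.
    exact: socle_subgroup.
  by apply: sub_finite_set fink => x [[xp _] xk].
have [|M hM] := @socle_closure _ _ pp l m.
  move=> n; have mM := leq_maxl m n.
  apply: subset_trans (near _ mM (inf _ mM)) _.
  by apply: span_mod_dvdn; apply: dvdn_exp2l; rewrite leqW // leq_maxr.
apply: (inf _ (leq_maxl m M)).
apply: sub_finite_set (finite_set1 (0 : G)) => s Ss.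
have [y Ty <-] := socle_Tor pp (socle_le (leq_maxr m M) Ss).
exact: reduced_Tor_bounded Ty.
Qed.

(** A finite [socle p 0] would make the sequence of the [socle p n] stationary, so
that [reduced_Tor_bounded] and [finite_Tor] would apply. *)
Lemma infinite_socle0 : infinite_set (@Tor G p) -> infinite_set (@socle G p 0).
Proof.
move=> infT finS; apply: infT.
have [|X [[N _ <-] _ minN]] := minimal_subset (P := range (@socle G p)) finS.
  by exists 0.
apply: (@finite_Tor N) => //; apply: reduced_Tor_bounded => k.
apply: (@subset_trans _ (@socle G p (maxn N k))); last first.
  by apply: socle_le; exact: leq_maxr.
apply: minN; first by exists (maxn N k).
by apply: socle_le; exact: leq_maxl.
Qed.

End InfiniteSocle.

(** * Endomorphisms that shift a sequence *)

Lemma sum_truncate (G : zmodType) (F : nat -> G) m n : (m <= n)%N ->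
  (forall i, (m <= i)%N -> F i = 0) -> \sum_(i < n) F i = \sum_(i < m) F i.
Proof.
move=> + F0; elim: n => [|n IHn]; first by rewrite leqn0 => /eqP ->.
rewrite leq_eqVlt => /predU1P[-> //|mn].
by rewrite big_ord_recr /= F0 // addr0 IHn.
Qed.

Lemma locally_finite_sum (G : zmodType) (psi : nat -> {additive G -> G})
    (r : G -> nat) : (forall x i, (r x <= i)%N -> psi i x = 0) ->
  exists phi : {additive G -> G},
    forall x n, (r x <= n)%N -> phi x = \sum_(i < n) psi i x.
Proof.
move=> psi0; pose phi x := \sum_(i < r x) psi i x.
have phiE x n : (r x <= n)%N -> phi x = \sum_(i < n) psi i x.
  move=> rn; rewrite (sum_truncate (F := fun i => psi i x) rn) // => i.
  exact: psi0.
have phiB : zmod_morphism phi.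
  move=> x y; pose n := maxn (r (x - y)) (maxn (r x) (r y)).
  rewrite !(@phiE _ n) ?leq_max ?leqnn ?orbT //.
  by rewrite -sumrB; apply: eq_bigr => i _; rewrite raddfB.
pose phiM := GRing.isZmodMorphism.Build _ _ phi phiB.
by exists (HB.pack phi phiM : {additive G -> G}).
Qed.

Fixpoint initial_segment (G : Type) (s : nat -> G) (n : nat) : seq G :=
  if n is m.+1 then s m :: initial_segment s m else [::].

Section Shift.
Variables (G : zmodType) (p : nat) (s : nat -> G) (phi : {additive G -> G}).
Hypothesis pp : prime p.
Let E n := span_mod 0 (initial_segment s n).
Hypothesis sp : forall i, s i *+ p = 0.
Hypothesis s_free : forall n, ~ E n (s n).
Hypothesis phi_shift : forall n, E n.+1 (phi (s n) - s n.+1).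
Hypothesis phi_socle : forall x, x *+ p = 0 -> exists n, E n (phi x).
Hypothesis phi_tor : forall x, exists k, phi x *+ (p ^ k) = 0.

Let sgE n : is_subgroup (E n). Proof. exact: span_mod_subgroup. Qed.

Let E_le m n : (m <= n)%N -> E m `<=` E n.
Proof.
elim: n => [|n IHn]; first by rewrite leqn0 => /eqP ->.
rewrite leq_eqVlt => /predU1P[-> //|mn].
by apply: subset_trans (IHn mn) _; exact: span_mod_cons.
Qed.

Let E0 x : E 0 x -> x = 0. Proof. by move=> [y <-]. Qed.

(** Modulo [E n.+1], [phi] turns the top coefficient at [s n] into the same
coefficient at [s n.+1]. *)
Let phiE n x (c : int) : E n (x - s n *~ c) -> E n.+1 (phi x - s n.+1 *~ c).
Proof.
have phiEE : forall n x, E n x -> E n.+1 (phi x).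
  elim=> [y /E0 ->|m IHm y [b yb]]; first by rewrite raddf0; exact: (sgE 1).1.
  exists b; have -> : phi y - s m.+1 *~ b =
      phi (y - s m *~ b) + (phi (s m) - s m.+1) *~ b.
    by rewrite raddfB raddfMz mulrzBl addrA subrK.
  by apply: subgroupD (IHm _ yb) _ => //; apply: subgroupMz.
move=> xc; have -> : phi x - s n.+1 *~ c =
    phi (x - s n *~ c) + (phi (s n) - s n.+1) *~ c.
  by rewrite raddfB raddfMz mulrzBl addrA subrK.
by apply: subgroupD (phiEE _ _ xc) _ => //; apply: subgroupMz.
Qed.

(** If [x] lies in [E m.+1] but not in [E m], then [phi x], and hence also
[x - phi x], lies outside [E m.+1], which contains [E 1]. *)
Let shift_up n x : E n x -> x != 0 -> ~ E 1 (x - phi x).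
Proof.
move=> Ex x0 E1.
have ex : exists n, `[< E n x >] by exists n; apply/asboolP.
have [[|m] /asboolP Em mmin] := ex_minnP ex; first by rewrite (E0 Em) eqxx in x0.
have nEm : ~ E m x by move=> /asboolP/mmin; rewrite ltnn.
case: (Em) => c xc; have Ephi : E m.+1 (phi x).
  rewrite -(subKr x (phi x)); apply: subgroupB => //.
  by apply: E_le E1.
have Esc : E m.+1 (s m.+1 *~ c).
  by rewrite -(subKr (phi x) (_ *~ c)); apply: subgroupB => //; exact: phiE.
have [pc|[d dE]] := prime_mulrzK c pp (sp m.+1).
  by apply: nEm; rewrite (dvdn_mulrz0 (sp m) pc) subr0 in xc.
by apply: (s_free (n := m.+1)); rewrite -dE; apply: subgroupMz.
Qed.

Let shift_socle x : x *+ p = 0 -> E 1 (x - phi x) -> x = 0.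
Proof.
move=> xp E1; apply/eqP/contraT => x0.
have [n En] := phi_socle xp; case: (shift_up (n := maxn 1 n) _ x0) => //.
rewrite -(subrK (phi x) x); apply: subgroupD => //.
  by apply: E_le E1; exact: leq_maxl.
by apply: E_le En; exact: leq_maxr.
Qed.

Let subMn x n : x *+ n - phi (x *+ n) = (x - phi x) *+ n.
Proof. by rewrite raddfMn mulrnBl. Qed.

(** The kernel consists of [p]-torsion, since [x = phi x] there, so it suffices to
find no nonzero element killed by [p] in it. *)
Lemma shift_inj x : x - phi x = 0 -> x = 0.
Proof.
move=> fx; have [k] := phi_tor x; have -> : phi x = x by apply/esym/subr0_eq.
elim: k x fx => [|k IHk] x fx; first by rewrite expn0 mulr1n.
rewrite expnS mulrnA => /IHk xp; apply: shift_socle.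
  by apply: xp; rewrite subMn fx mul0rn.
by rewrite fx; exact: (sgE 1).1.
Qed.

(** By injectivity a preimage of [s 0] is killed by [p], so that [shift_socle]
applies to it. *)
Lemma shift_not_surj x : x - phi x <> s 0.
Proof.
move=> fx; suff x0 : x = 0.
  apply: (@s_free 0); rewrite -fx x0 raddf0 subrr; exact: (sgE 0).1.
apply: shift_socle; first by apply: shift_inj; rewrite subMn fx sp.
by rewrite fx; apply: mem_span_mod; exact: mem_head.
Qed.

End Shift.

Section NotCoHopfian.
Variables (G : zmodType) (p : nat) (e : nat -> G) (r : G -> nat).
Hypotheses (pp : prime p) (redG : reduced G) (rK : cancel r e).

(** The exponent in the second clause is one more than the height known for
[s n.+1], as [separating_hom] requires in order to send [s n] to [s n.+1]; this
is why every [socle p (m n)] has to be kept infinite. *)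
Lemma far_sequence : infinite_set (@Tor G p) ->
  exists (s : nat -> G) (m : nat -> nat) (L : nat -> seq G), forall n,
    [/\ socle p (m n) (s n), ~ span_mod (p ^ (m n.+1).+1) (L n) (s n),
        forall j, (j <= n)%N -> e j \in L n & forall j, (j < n)%N -> s j \in L n].
Proof.
move=> infT; pose good (ml : nat * seq G) (ks : nat * G) :=
  infinite_set (@socle G p ml.1) ->
  [/\ infinite_set (@socle G p ks.1), socle p ml.1 ks.2
    & ~ span_mod (p ^ ks.1.+1) ml.2 ks.2].
have /choice[F FP] : forall ml, exists ks, good ml ks.
  move=> [m l]; have [finS|infS] := pselect (finite_set (@socle G p m)).
    by exists (0%N, 0).
  have [k [s [infk Ss ns]]] := infinite_socle_far pp redG l infS.
  by exists (k, s).
pose st := fix st n : nat * seq G := if n is i.+1 then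
    let L := e i :: (st i).2 in let ks := F ((st i).1, L) in (ks.1, ks.2 :: L)
  else (0%N, [::]).
pose m n := (st n).1; pose L n := e n :: (st n).2; pose s n := (F (m n, L n)).2.
have infS n : infinite_set (@socle G p (m n)).
  by elim: n => [|n IHn]; [exact: infinite_socle0|have [] := FP (m n, L n) IHn].
have LS n a : a \in L n -> a \in L n.+1.
  by move=> aL; rewrite inE /= !inE; move: aL; rewrite inE => ->; rewrite !orbT.
have Le i n a : (i <= n)%N -> a \in L i -> a \in L n.
  elim: n => [|n IHn]; first by rewrite leqn0 => /eqP ->.
  by rewrite leq_eqVlt => /predU1P[-> //|/IHn H /H]; exact: LS.
exists s, m, L => n; have [_ Ss ns] := FP (m n, L n) (infS n).
split=> // j jn; first by apply: Le jn _; exact: mem_head.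
by apply: Le jn _; rewrite inE /= mem_head orbT.
Qed.

Lemma infinite_Tor_not_coHopfian : infinite_set (@Tor G p) -> ~ coHopfian G.
Proof.
move=> /far_sequence[s [m [L sL]]] coH.
have sp i : s i *+ p = 0 by have [[]] := sL i.
have sgL k n := span_mod_subgroup k (L n).
have s0 i : s i != 0.
  have [_ + _ _] := sL i; apply: contra_notN => /eqP ->; exact: (sgL _ _).1.
have /choice[psi psiP] : forall n, exists psi : {additive G -> G},
    [/\ forall x, span_mod (p ^ (m n.+1).+1) (L n) x -> psi x = 0,
        psi (s n) = s n.+1,
        forall x, psi x *+ (p ^ (m n.+1).+1) = 0
      & forall x, x *+ p = 0 -> exists c : int, psi x = s n.+1 *~ c].
  move=> n; have [_ ns _ _] := sL n; have [Ss _ _ _] := sL n.+1.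
  by apply: separating_hom => //; exact: multiples_span_mod.
have [|phi phiE] := @locally_finite_sum _ psi r.
  move=> x i xi; have [psi0 _ _ _] := psiP i; apply: psi0; apply: mem_span_mod.
  by have [_ _ eL _] := sL i; rewrite -(rK x); exact: eL.
pose E n := span_mod 0 (initial_segment s n).
have sgE n : is_subgroup (E n) by exact: span_mod_subgroup.
have sE i n : (i < n)%N -> E n (s i).
  elim: n => [//|n IHn]; rewrite ltnS leq_eqVlt => /predU1P[->|/IHn Esi].
    by apply: mem_span_mod; exact: mem_head.
  exact: span_mod_cons.
have psiE i n x : (i < n)%N -> x *+ p = 0 -> E n.+1 (psi i x).
  move=> li xp; have [_ _ _ psic] := psiP i; have [c ->] := psic x xp.
  by apply: subgroupMz => //; apply: sE.
have sumE (n k : nat) (F : nat -> G) : (forall i, (i < n)%N -> E k (F i)) ->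
    E k (\sum_(i < n) F i).
  move=> EF; elim: n EF => [|n IHn] EF; first by rewrite big_ord0; exact: (sgE k).1.
  rewrite big_ord_recr /=; apply: subgroupD => //; last exact: EF.
  by apply: IHn => i /ltnW; exact: EF.
have s_free n : ~ E n (s n).
  move=> En; have [_ + _ sL'] := sL n; apply; move: En.
  apply: span_mod_sub => //; first by move=> x [y <-]; exact: (sgL _ _).1.
  move=> a an; apply: mem_span_mod.
  have [i li ->] : exists2 i, (i < n)%N & a = s i.
    elim: n an {sL'} => [//|n IHn]; rewrite inE => /predU1P[->|/IHn[i li ->]].
      by exists n.
    by exists i => //; exact: ltnW.
  exact: sL'.
have phi_shift n : E n.+1 (phi (s n) - s n.+1).
  pose N := maxn n.+1 (r (s n)).
  have psi0 i : (n < i)%N -> psi i (s n) = 0.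
    move=> ni; have [psi0 _ _ _] := psiP i; apply: psi0; apply: mem_span_mod.
    by have [_ _ _ ] := sL i; exact.
  have -> : phi (s n) = \sum_(i < n.+1) psi i (s n).
    rewrite (phiE _ N) ?leq_maxr //.
    by apply: (sum_truncate (F := fun i => psi i (s n))) => //; exact: leq_maxl.
  rewrite big_ord_recr /=; have [_ -> _ _] := psiP n; rewrite addrK.
  by apply: (sumE _ _ (fun i => psi i (s n))) => i li; exact: psiE.
have phi_socle x : x *+ p = 0 -> exists n, E n (phi x).
  move=> xp; exists (r x).+1; rewrite (phiE _ (r x)) //.
  by apply: (sumE _ _ (fun i => psi i x)) => i li; exact: psiE.
have phi_tor x : exists k, phi x *+ (p ^ k) = 0.
  rewrite (phiE _ (r x)) //; elim: (r x) => [|n [k kE]].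
    by exists 0%N; rewrite big_ord0 mul0rn.
  exists (k + (m n.+1).+1)%N; rewrite big_ord_recr /= mulrnDl expnD.
  have [_ _ psit _] := psiP n.
  by rewrite mulrnA kE mul0rn mulnC mulrnA psit mul0rn addr0.
pose f : {additive G -> G} := idfun \- phi.
have [|x fx] := coH f _ (s 0%N).
  apply/raddf_inj => x.
  exact: (shift_inj pp sp s_free phi_shift phi_socle phi_tor).
exact: (shift_not_surj pp sp s_free phi_shift phi_socle phi_tor fx).
Qed.

End NotCoHopfian.

(** * Finite torsion in a co-Hopfian group *)

Section FiniteTor.
Variables (G : zmodType) (p : nat).
Hypotheses (pp : prime p) (coG : coHopfian G) (finT : finite_set (@Tor G p)).

Lemma finite_Tor_exponent : exists k, forall x : G, Tor p x -> x *+ (p ^ k) = 0.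
Proof.
have /finite_seqP[l lE] := finT.
have : forall x, x \in l -> Tor p x by move=> x xl; rewrite lE.
suff : (forall x, x \in l -> Tor p x) ->
    exists k, forall x, x \in l -> x *+ (p ^ k) = 0.
  by move=> H /H[k kE]; exists k => x; rewrite lE; exact: kE.
elim: l {lE} => [|x l IHl] lT; first by exists 0%N.
have [|k kE] := IHl; first by move=> y yl; apply: lT; rewrite inE yl orbT.
have /(TorE _ pp)[j jE] := lT x (mem_head _ _).
exists (k + j)%N => y; rewrite inE expnD => /predU1P[->|/kE yk].
  by rewrite mulnC mulrnA jE mul0rn.
by rewrite mulrnA yk mul0rn.
Qed.

(** The property carried by descending induction on [h]: it is trivial for [h] so
large that [socle p h] is [0], and wanted for [h = 0]. *)
Definition socle_hom (h : nat) : Prop := exists phi : {additive G -> G},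
  (forall x, Tor p (phi x)) /\ forall x, socle p h x -> phi x = 0 -> x = 0.

(** Among the homomorphisms which witness [socle_hom h.+1], one with the least
kernel on [socle h] is injective there: otherwise, [socle h] being finite, its
image would also miss some [s'] in [socle h], and adding a homomorphism which
vanishes on [p ^ h.+1 G] and sends an element of the kernel to [s'] would make
the kernel smaller. *)
Lemma socle_hom_step h : socle_hom h.+1 -> socle_hom h.
Proof.
move=> [phi0 [T0 inj0]].
pose ker (phi : {additive G -> G}) := socle p h `&` [set x | phi x = 0].
pose P (X : set G) := exists phi : {additive G -> G}, [/\ forall x, Tor p (phi x),
  forall x, socle p h.+1 x -> phi x = 0 -> x = 0 & X = ker phi].
have ST n x : socle p n x -> Tor p x.
  by move=> [/= xp _]; apply/(TorE _ pp); exists 1%N; rewrite expn1.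
have finS : finite_set (@socle G p h) by apply: sub_finite_set finT; exact: ST.
have [||X [[phi [Tphi injphi ->]] _ minX]] := @minimal_subset _ P (ker phi0).
- by apply: sub_finite_set finS => x [].
- by exists phi0.
exists phi; split=> // s Ss phis; apply/eqP/contraT => s0.
have sgS := socle_subgroup G p h.
have [sp _] := Ss.
have [s' Ss' ns'] : exists2 s', socle p h s' &
    ~ exists2 x, socle p h x & phi x = s'.
  apply: contrapT => surj; case/eqP: s0.
  apply: (finite_surj_inj (f := phi) finS _ Ss sgS.1); last by rewrite raddf0 phis.
  by move=> y Sy; apply: contrapT => ny; apply: surj; exists y.
have s'0 : s' != 0.
  by apply: contra_notN ns' => /eqP ->; exists 0; [exact: sgS.1|exact: raddf0].
have ns : ~ multiples (p ^ h.+1) s.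
  by move=> sm; case/eqP: s0; apply: injphi.
have [psi [psi0 psis psiT psic]] :=
  separating_hom pp (multiples_subgroup G (p ^ h.+1)) (@subset_refl _ _)
    sp ns Ss' s'0.
have P' : P (ker (phi \+ psi)).
  exists (phi \+ psi); split=> [x|x Sx|//].
    apply: (subgroupD (Tor_subgroup G pp) (Tphi x)).
    by apply/(TorE _ pp); exists h.+1; exact: psiT.
  by have [_ /psi0 px0] := Sx; rewrite /= px0 addr0; exact: injphi.
have sub : ker (phi \+ psi) `<=` ker phi.
  move=> x [Sx phix]; split=> //; have [xp _] := Sx; have [c cE] := psic x xp.
  have [pc|[d dE]] := prime_mulrzK c pp (proj1 Ss').
    by move: phix; rewrite /= cE (dvdn_mulrz0 (proj1 Ss') pc) addr0.
  case: ns'; exists (- x *~ d).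
    by apply: subgroupMz => //; exact: subgroupN.
  rewrite raddfMz raddfN -dE -cE; congr (_ *~ _).
  by apply/eqP; rewrite eq_sym -addr_eq0 addrC; apply/eqP.
have [_ /=] := minX _ P' sub s (conj Ss phis).
by rewrite phis psis add0r => /eqP; rewrite (negbTE s'0).
Qed.

(** [x |-> p x + phi x] is injective when [phi] takes torsion values and is
injective on the elements of order [p]; being onto, it gives [G = Tor p + p G]. *)
Lemma Tor_plus_multiples n (y : G) : exists2 t, Tor p t & multiples (p ^ n) (y - t).
Proof.
have [k kE] := finite_Tor_exponent.
have [phi [Tphi injphi]] : socle_hom 0.
  have : socle_hom k.
    exists \0; split=> [x|x /(socle_Tor pp)[z Tz <-] _]; last exact: kE.
    exact: (Tor_subgroup G pp).1.
  by elim: k {kE} => [//|k IHk] /socle_hom_step.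
pose f x := x *+ p + phi x.
have fB : zmod_morphism f.
  by move=> x z; rewrite /f mulrnBl raddfB opprD addrACA.
pose fM := GRing.isZmodMorphism.Build _ _ f fB.
pose fA : {additive G -> G} := HB.pack f fM.
have f_inj : injective fA.
  apply/raddf_inj => x; have [j xj] : exists j, f x = 0 -> x *+ (p ^ j) = 0.
    have /(TorE _ pp)[j jE] := Tphi x; exists j.+1 => /eqP.
    by rewrite /f addr_eq0 => /eqP xp; rewrite expnS mulrnA xp mulNrn jE oppr0.
  move=> fx; have xpj := xj fx; move: xpj fx {xj}; elim: j x => [|j IHj] x.
    by rewrite expn0 mulr1n.
  rewrite expnS mulrnA => xpj fx; have xp : x *+ p = 0.
    apply: IHj xpj _; rewrite -[LHS]/(fA (x *+ p)) raddfMn.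
    by rewrite fx mul0rn.
  apply: injphi; first by split=> //; exists x.
  by rewrite -fx -[fA x]/(f x) /f xp add0r.
have sgT := Tor_subgroup G pp.
elim: n y => [|n IHn] y; first by exists 0; [exact: sgT.1|exists y; rewrite subr0].
have [t Tt [z zE]] := IHn y; have [x xz] := coG f_inj z.
exists (t + phi x *+ (p ^ n)).
  by apply: subgroupD => //; exact: subgroupMn.
exists x; rewrite opprD addrA -zE -xz -[fA x]/(f x) /f mulrnDl addrK.
by rewrite expnS mulrnA.
Qed.

Lemma Tor_complement : exists k,
  (forall x : G, Tor p x -> multiples (p ^ k) x -> x = 0) /\
  multiples (p ^ k) `<=` @multiples G (p ^ k.+1).
Proof.
have [k kE] := finite_Tor_exponent; exists k; split=> [x Tx [y yx]|x [y <-]].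
  rewrite -yx; apply: kE; have /(TorE _ pp)[j xj] := Tx.
  by apply/(TorE _ pp); exists (k + j)%N; rewrite expnD mulrnA yx.
have [t Tt [z zE]] := Tor_plus_multiples 1 y.
exists z; rewrite expnSr mulnC mulrnA -(expn1 p) zE expn1 mulrnBl (kE _ Tt).
exact: subr0.
Qed.

End FiniteTor.

(** * The embedding *)

Lemma coHopfian_embeds_in_Tor_prod (G : zmodType) :
    coHopfian G -> reduced G -> (forall p, prime p -> finite_set (@Tor G p)) ->
  exists f : {additive G -> Tor_prod G}, injective f.
Proof.
move=> coG redG finT.
have /choice[k kP] : forall P : primes_set, exists k,
    (forall x : G, Tor (val P) x -> multiples (val P ^ k) x -> x = 0) /\
    multiples (val P ^ k) `<=` @multiples G (val P ^ k.+1).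
  by move=> P; apply: Tor_complement (valP P) coG (finT _ (valP P)).
pose q P := (val P ^ k P)%N.
have sgq P := multiples_subgroup G (q P).
have /choice[t tP] : forall Px : primes_set * G, exists t,
    Tor (val Px.1) t /\ multiples (q Px.1) (Px.2 - t).
  move=> [P x]; have finP := finT _ (valP P).
  by have [t Tt xt] := Tor_plus_multiples (valP P) coG finP (k P) x; exists t.
(* [t (P, x)] is the component of [x] in the torsion part for [P]. *)
have t_uniq P x u : Tor (val P) u -> multiples (q P) (x - u) -> t (P, x) = u.
  move=> Tu xu; have [/= Tt xt] := tP (P, x).
  apply/subr0_eq/(proj1 (kP P)).
    exact: (subgroupB (Tor_subgroup G (valP P)) Tt Tu).
  have -> : t (P, x) - u = (x - u) - (x - t (P, x)).
    by rewrite opprB [RHS]addrC subrKA.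
  exact: (subgroupB (sgq P) xu xt).
have tT P x : t (P, x) \in Tor_pred P by apply/asboolP; case: (tP (P, x)).
pose f x : Tor_prod G := fun P => (exist _ (t (P, x)) (tT P x) : Tor_type G P).
have fB : zmod_morphism f.
  move=> x y; apply: functional_extensionality_dep => P; apply: val_inj => /=.
  apply: t_uniq.
    by have [/= Tx _] := tP (P, x); have [/= Ty _] := tP (P, y);
      exact: (subgroupB (Tor_subgroup G (valP P)) Tx Ty).
  rewrite subrACA; have [/= _ hx] := tP (P, x); have [/= _ hy] := tP (P, y).
  exact: subgroupB.
pose fM := GRing.isZmodMorphism.Build _ _ f fB.
exists (HB.pack f fM : {additive G -> Tor_prod G}).
apply/raddf_inj => x fx.
pose D : set G := [set y | forall P, multiples (q P) y].
suff D0 : D = [set 0].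
  have : D x; last by rewrite D0.
  move=> P; have [/= _] := tP (P, x).
  have -> : t (P, x) = 0 by have /(congr1 (fun g : Tor_prod G => val (g P))) := fx.
  by rewrite subr0.
apply: redG; first by split=> [P|y z Dy Dz P]; [exact: (sgq P).1|exact: subgroupB].
apply: divisible_by_primes => r pr y Dy.
pose R : primes_set := exist _ r pr.
have [z zE] : multiples (r ^ (k R).+1) y by apply: (proj2 (kP R)); exact: Dy R.
exists (z *+ (r ^ k R)); last by rewrite -mulrnA -expnSr.
set w := z *+ _; have wr : w *+ r = y by rewrite -mulrnA -expnSr.
move=> P; have [PR|PR] := eqVneq (val P) r.
  have -> : P = R by apply: val_inj.
  by exists z.
have [/= Tu wu] := tP (P, w); move: (t (P, w)) Tu wu => u Tu wu.
(* The component [u] of [w] at [P] vanishes: [r u] is the component of [y], which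
is [0], and the order of [u] is prime to [r]. *)
suff u0 : u = 0 by rewrite u0 subr0 in wu.
have ur : u *+ r = 0.
  apply: (proj1 (kP P)).
    exact: (subgroupMn (Tor_subgroup G (valP P))).
  rewrite -(subKr w u) mulrnBl wr; apply: (subgroupB (sgq P)); first exact: Dy.
  exact: (subgroupMn (sgq P)).
have /(TorE _ (valP P))[j uj] := Tu.
have [|d <-] := coprime_mulrnK (c := r) uj _.
  rewrite coprimezE /= coprimeXr // prime_coprime // dvdn_prime2 ?(valP P) //.
  by rewrite eq_sym.
by rewrite -pmulrn ur mul0rz.
Qed.

Theorem theorem1p7 (G : AB_omega) (hcoHopf : coHopfian G) (hred : reduced G) :
  (forall p : nat, prime p -> finite_set (@Tor G p)) /\
  (exists f : {additive G -> Tor_prod G}, injective f).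
Proof.
have finT p : prime p -> finite_set (@Tor G p).
  move=> pp; apply: contrapT => infT.
  (* The domain of [G] is the set of natural numbers, which enumerates it. *)
  exact: (@infinite_Tor_not_coHopfian G p id id) infT hcoHopf.
by split; [exact: finT|exact: coHopfian_embeds_in_Tor_prod].
Qed.
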